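(* For any $\lambda_{ij}\ge0$, $i=1,\dots,k$, $j\ne i$, and for any sequential test $(\psi,\phi)$, $$L(\psi,\phi)\ \ge\ N(\psi)+\sum_{n=1}^\infty\int(1-\psi_1)\cdots(1-\psi_{n-1})\psi_n\,l_n\,d\mu^n,\qquad ( * )$$ where $$l_n=\min_{1\le j\le k}\ \sum_{i\ne j}\lambda_{ij}f_{\theta_i}^n .$$ Supposing that $N(\psi)$ is finite, the right-hand side of $( * )$ is attained (i.e. equality holds in $( * )$) if and only if $$\phi_n^j\le I_{\left\{\sum_{i\ne j}\lambda_{ij}f_{\theta_i}^n=l_n\right\}}$$ for all $j=1,\dots,k$, $\mu^n$-almost everywhere on $$S_n^\psi=\{(x_1,\dots,x_n):\ s_n^\psi(x_1,\dots,x_n)>0\},\qquad s_n^\psi=(1-\psi_1)\cdots(1-\psi_{n-1})\psi_n,$$ for all $n=1,2,\dots$.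
   Context: Setting. Let $k\ge2$ and let $X_1,X_2,\dots$ be a discrete-time stochastic process with values in a measurable space $\mathcal X$, whose distribution $P_\vartheta$ depends on a parameter $\vartheta$. Let $\mu$ be a $\sigma$-finite measure on $\mathcal X$ and $\mu^n=\mu\otimes\cdots\otimes\mu$ ($n$ times). For every parameter value $\vartheta$ and every $n\ge 1$, under $P_\vartheta$ the vector $(X_1,\dots,X_n)$ has density $f_\vartheta^n(x_1,\dots,x_n)$ with respect to $\mu^n$. Parameter values $\theta_1,\dots,\theta_k$ (the hypotheses $H_i:\theta=\theta_i$) and one more fixed parameter value $\theta$ (not necessarily one of the $\theta_i$) are given. For a function $F_n=F_n(x_1,\dots,x_n)$, $E_\vartheta F_n=E_\vartheta F_n(X_1,\dots,X_n)=\int F_n f^n_\vartheta\,d\mu^n$. A stopping rule is a sequence $\psi=(\psi_1,\psi_2,\dots)$ of measurable functions $\psi_n=\psi_n(x_1,\dots,x_n)$ with values in $[0,1]$. A decision rule is a sequence $\phi=(\phi_1,\phi_2,\dots)$, $\phi_n=(\phi_n^1,\dots,\phi_n^k)$, of measurable functions of $(x_1,\dots,x_n)$ with $\phi_n^i\ge0$ and $\sum_{i=1}^k\phi_n^i=1$. A sequential test is a pair $(\psi,\phi)$. The stopping time $\tau_\psi$ has distribution $P_\vartheta(\tau_\psi=n)=E_\vartheta(1-\psi_1)\cdots(1-\psi_{n-1})\psi_n$, and $P_\vartheta(\tau_\psi<\infty)=\sum_{n\ge1}P_\vartheta(\tau_\psi=n)$. Error probabilities: $\alpha_{ij}(\psi,\phi)=\sum_{n=1}^\infty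 E_{\theta_i}(1-\psi_1)\cdots(1-\psi_{n-1})\psi_n\phi_n^j$. Average sample number: $N(\psi)=N(\theta;\psi)=E_\theta\tau_\psi=\sum_{n=1}^\infty nP_\theta(\tau_\psi=n)$ if $P_\theta(\tau_\psi<\infty)=1$, and $N(\psi)=\infty$ otherwise. Lagrange-multiplier function: $L(\psi,\phi)=N(\psi)+\sum_{1\le i,j\le k,\ i\ne j}\lambda_{ij}\alpha_{ij}(\psi,\phi)$. $I_A$ denotes the indicator function of $A$; sums $\sum_{i\neq j}$ with $j$ fixed run over $i\in\{1,\dots,k\}$, $i\ne j$. *)

(* Defs.v *)
From HB Require Import structures.
From mathcomp Require Import all_boot all_order all_algebra.
From mathcomp Require Import all_classical all_reals all_analysis.

Set Implicit Arguments.
Unset Strict Implicit.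
Unset Printing Implicit Defensive.

Import Order.TTheory GRing.Theory Num.Theory.
Import numFieldNormedType.Exports.

Local Open Scope classical_set_scope.
Local Open Scope ring_scope.
Local Open Scope ereal_scope.

(* A family indexed by the number n of observations takes n : nat and
   x : n.-tuple T. Observations are numbered from 1, as in X_1, X_2, ...:
   values at index 0 (of X, f, psi, phi) are unconstrained and never used. *)

Section power_measure.
Context d (T : measurableType d) (R : realType).
Variable mu : {sigma_finite_measure set T -> \bar R}.

Definition cons_pair n (xt : T * n.-tuple T) : n.+1.-tuple T :=
  [tuple of xt.1 :: xt.2].

Lemma measurable_cons_pair n :
  measurable_fun [set: T * n.-tuple T] (@cons_pair n).
Proof. exact: (measurable_cons measurable_fst measurable_snd). Qed.

Section cons_measure.
Variables (n : nat) (nu : {sigma_finite_measure set (n.-tuple T) -> \bar R}).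

Definition cons_measure : set (n.+1.-tuple T) -> \bar R :=
  pushforward (mu \x nu) (@cons_pair n).

Let cons_measure0 : cons_measure set0 = 0.
Proof. by rewrite /cons_measure /pushforward preimage_set0 measure0. Qed.

Let cons_measure_ge0 A : 0 <= cons_measure A.
Proof. by rewrite /cons_measure /pushforward measure_ge0. Qed.

Let measurable_preimage_cons (A : set (n.+1.-tuple T)) :
  measurable A -> measurable (@cons_pair n @^-1` A).
Proof.
by move=> mA; rewrite -[X in measurable X]setTI; exact: measurable_cons_pair.
Qed.

Let cons_measure_sigma_additive : semi_sigma_additive cons_measure.
Proof.
move=> F mF tF mUF; rewrite /cons_measure /pushforward preimage_bigcup.
apply: measure_semi_sigma_additive.
- by move=> i; exact: measurable_preimage_cons.
- apply/trivIsetP => /= i j _ _ ij; rewrite -preimage_setI.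
  by move/trivIsetP : tF => /(_ _ _ _ _ ij) ->//; rewrite preimage_set0.
- by rewrite -preimage_bigcup; exact: measurable_preimage_cons.
Qed.

HB.instance Definition _ := isMeasure.Build _ _ _ cons_measure
  cons_measure0 cons_measure_ge0 cons_measure_sigma_additive.

Let uncons (x : n.+1.-tuple T) : T * n.-tuple T :=
  (thead x, [tuple of behead x]).

Let unconsK : cancel (@cons_pair n) uncons.
Proof.
move=> [x t]; rewrite /uncons /cons_pair theadE /=; congr pair.
exact: val_inj.
Qed.

Let measurable_uncons : measurable_fun [set: n.+1.-tuple T] uncons.
Proof.
apply/measurable_fun_pairP; split; first exact: measurable_tnth.
exact: measurable_behead.
Qed.

Let cons_measure_sigma_finite : sigma_finite [set: n.+1.-tuple T] cons_measure.
Proof.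
have /sigma_finiteP[F [TF ndF Foo]] := sigma_finiteT mu.
have /sigma_finiteP[G [TG ndG Goo]] := sigma_finiteT nu.
exists (fun i => uncons @^-1` (F i `*` G i)).
  rewrite -preimage_bigcup -(@preimage_setT _ _ uncons); congr (_ @^-1` _).
  rewrite -setXTT TF TG predeqE => -[x y]; split.
    move=> [/= [i _ Fix] [j _ Gjy]]; exists (maxn i j) => //; split.
    - by move: x Fix; exact/subsetPset/ndF/leq_maxl.
    - by move: y Gjy; exact/subsetPset/ndG/leq_maxr.
  by move=> [i _ []/= ? ?]; split; exists i.
move=> i; have [? ?] := Foo i; have [? ?] := Goo i; split.
  rewrite -[X in measurable X]setTI; apply: measurable_uncons => //.
  exact: measurableX.
rewrite /cons_measure /pushforward -comp_preimage.
rewrite (_ : uncons \o _ = id) ?preimage_id; last first.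
  by apply/funext => x /=; exact: unconsK.
by rewrite product_measure1E// lte_mul_pinfty// ge0_fin_numE.
Qed.

HB.instance Definition _ := Measure_isSigmaFinite.Build _ _ _ cons_measure
  cons_measure_sigma_finite.

End cons_measure.

(* the n-fold product of mu; on the one-point type 0.-tuple T it has mass 1 *)
Fixpoint power_measure n : {sigma_finite_measure set (n.-tuple T) -> \bar R} :=
  match n with
  | 0 => \d_[tuple]
  | m.+1 => cons_measure (power_measure m)
  end.

End power_measure.

Section sequential_test.
Context d (T : measurableType d) (R : realType).

Definition prefix_tuple m n (lemn : (m <= n)%N) (x : n.-tuple T) : m.-tuple T :=
  [tuple tnth x (widen_ord lemn i) | i < m].

Record stopping_rule := StoppingRule {
  stop_fun :> forall n, n.-tuple T -> R ;
  stop_measurable : forall n, (0 < n)%N ->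
    measurable_fun [set: n.-tuple T] (@stop_fun n) ;
  stop_itv : forall n (x : n.-tuple T), (0 < n)%N ->
    (0 <= stop_fun x <= 1)%R
}.

Record decision_rule (k : nat) := DecisionRule {
  decide_fun :> forall n, 'I_k -> n.-tuple T -> R ;
  decide_measurable : forall n (i : 'I_k), (0 < n)%N ->
    measurable_fun [set: n.-tuple T] (@decide_fun n i) ;
  decide_ge0 : forall n (i : 'I_k) (x : n.-tuple T), (0 < n)%N ->
    (0 <= decide_fun i x)%R ;
  decide_sum1 : forall n (x : n.-tuple T), (0 < n)%N ->
    (\sum_(i < k) decide_fun i x = 1)%R
}.

(* $s_n^\psi = (1-\psi_1)\cdots(1-\psi_{n-1})\psi_n$ *)
Definition stop_weight (psi : stopping_rule) n (x : n.-tuple T) : R :=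
  ((\prod_(m < n | (0 < m)%N)
      (1 - psi m (prefix_tuple (ltnW (ltn_ord m)) x)))
    * psi n x)%R.

End sequential_test.

Section process.
Context d0 (Omega : measurableType d0) d (T : measurableType d) (R : realType).
Variable X : nat -> {mfun Omega >-> T}.

Definition sample n (w : Omega) : n.-tuple T := [tuple X i.+1 w | i < n].

Definition is_sample_density (mu : {sigma_finite_measure set T -> \bar R})
    (P : probability Omega R) n (f : n.-tuple T -> R) : Prop :=
  [/\ measurable_fun [set: n.-tuple T] f,
      forall x, (0 <= f x)%R &
      forall A : set (n.-tuple T), measurable A ->
        pushforward P (@sample n) A = \int[power_measure mu n]_(x in A) (f x)%:E].

Variable P : probability Omega R.

Definition stop_at (psi : stopping_rule T R) n : \bar R :=
  'E_P[stop_weight psi (n := n) \o @sample n].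

Definition stop_finite (psi : stopping_rule T R) : \bar R :=
  \sum_(1 <= n <oo) stop_at psi n.

Definition average_sample_number (psi : stopping_rule T R) : \bar R :=
  if stop_finite psi == 1 then \sum_(1 <= n <oo) (n%:R)%:E * stop_at psi n
  else +oo.

End process.

Section lagrange.
Context d0 (Omega : measurableType d0) d (T : measurableType d) (R : realType).
Context (Theta : Type) (k : nat).
Variables (X : nat -> {mfun Omega >-> T}) (P : Theta -> probability Omega R).
Variables (hyp : 'I_k -> Theta) (theta : Theta) (lambda : 'I_k -> 'I_k -> R).

Definition error_prob (psi : stopping_rule T R) (phi : decision_rule T R k)
    (i j : 'I_k) : \bar R :=
  \sum_(1 <= n <oo)
    'E_(P (hyp i))[(fun x : n.-tuple T => (stop_weight psi x * phi n j x)%R)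
                     \o @sample _ _ _ _ X n].

Definition lagrangian (psi : stopping_rule T R) (phi : decision_rule T R k) :
    \bar R :=
  average_sample_number X (P theta) psi +
  \sum_(i < k) \sum_(j < k | j != i) (lambda i j)%:E * error_prob psi phi i j.

Variable f : Theta -> forall n, n.-tuple T -> R.

Definition decision_loss n (j : 'I_k) (x : n.-tuple T) : R :=
  (\sum_(i < k | i != j) lambda i j * f (hyp i) x)%R.

(* $l_n$; +oo is only the neutral element of mine, so the value is the true
   minimum as soon as k > 0 *)
Definition min_loss n (x : n.-tuple T) : \bar R :=
  \big[mine/+oo]_(j < k) (decision_loss j x)%:E.

End lagrange.

(* Main.v *)
Require Import Defs.
From mathcomp Require Import all_boot all_order all_algebra.
From mathcomp Require Import all_classical all_reals all_analysis.
From mathcomp Require Import measurable_realfun.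
Import Order.TTheory GRing.Theory Num.Theory.
Import numFieldNormedType.Exports.
Local Open Scope classical_set_scope.
Local Open Scope ring_scope.
Local Open Scope ereal_scope.

(** The inequality is a pointwise comparison, integrated and summed over the
    stopping time.

    A transfer from the sample space to densities ([expectation_sample], which
    rests on [ge0_integral_density]) turns each stage-[n] expectation into an
    integral against the product measure. Exchanging the finite sums over
    hypotheses with the series ([weighted_error_probE]) rewrites the error part
    of the Lagrangian as
      sum over n of the integral of s_n * sum_j phi_n^j D_n^j,
    where D_n^j is the loss of deciding for j, i.e. the sum over i != j of
    lambda_ij f_i^n. Since the phi_n^j are nonnegative with sum 1, the inner
    sum is a weighted average of the D_n^j; it is at least their minimum l_n,
    which is the lower bound.

    For the equality case, cancel N, which is finite. The error part is finite
    as well: the weights s_n telescope to at most 1 along every trajectory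
    ([sum_stop_weight_le1]), so every error probability is at most 1. Between
    finite quantities, a termwise inequality of nonnegative series is an
    equality only if all terms agree ([eq_nneseries_le]), and a pointwise
    inequality of nonnegative functions integrates to an equality only if the
    functions agree almost everywhere ([eq_integral_le]). Finally the average
    equals the minimum exactly when the weights avoid the indices that are not
    minimal ([weighted_average_min]); as weights never exceed 1, this says that
    each phi_n^j is at most the indicator of D_n^j = l_n. *)

Set Implicit Arguments.
Unset Strict Implicit.
Unset Printing Implicit Defensive.

(** * Integration against a density *)

Section density.
Context d (T : measurableType d) (R : realType).
Variables (mu nu : {measure set T -> \bar R}) (f : T -> R).
Hypothesis mf : measurable_fun [set: T] f.
Hypothesis f0 : forall x, (0 <= f x)%R.
Hypothesis nuE : forall A, measurable A -> nu A = \int[mu]_(x in A) (f x)%:E.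

Import HBNNSimple.

Let integral_density_nnsfun (h : {nnsfun T >-> R}) :
  \int[nu]_x (h x)%:E = \int[mu]_x ((h x)%:E * (f x)%:E).
Proof.
have mEf : measurable_fun [set: T] (fun x => (f x)%:E).
  exact/measurable_EFinP.
rewrite integralT_nnsfun sintegralE.
under [RHS]eq_integral => x _.
  rewrite fimfunE -fsumEFin// ge0_mule_fsuml; last first.
    by move=> r; exact: nnfun_muleindic_ge0.
  over.
rewrite ge0_integral_fsum//; last 2 first.
- move=> r; apply: emeasurable_funM => //.
  by apply/measurable_EFinP; exact: measurable_funM.
- by move=> r x _; rewrite mule_ge0// ?nnfun_muleindic_ge0// lee_fin.
apply: eq_fsbigr => r rh.
have r0 : (0 <= r)%R by move: rh; rewrite inE => -[x _ <-].
under [RHS]eq_integral do rewrite EFinM -muleA.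
rewrite ge0_integralZl ?lee_fin//; last 2 first.
- by apply: emeasurable_funM => //; exact/measurable_EFinP.
- by move=> x _; rewrite -EFinM lee_fin mulr_ge0.
congr (_ * _); rewrite nuE// [LHS]integral_mkcond.
by apply: eq_integral => x _; rewrite epatch_indic muleC.
Qed.

(** The simple-function case passes to the limit by monotone convergence; on the
    right-hand side the approximations stay monotone since [f] is nonnegative. *)
Lemma ge0_integral_density (g : T -> \bar R) : measurable_fun [set: T] g ->
  (forall x, 0 <= g x) -> \int[nu]_x g x = \int[mu]_x (g x * (f x)%:E).
Proof.
move=> mg g0; pose h := nnsfun_approx measurableT mg.
have hg x : (h n x)%:E @[n --> \oo] --> g x.
  by apply: cvg_nnsfun_approx => // y _; exact: g0.
have hnd x m n : (m <= n)%N -> (h m x <= h n x)%R.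
  by move=> mn; exact/lefP/nd_nnsfun_approx.
transitivity (limn (fun n => \int[nu]_x (h n x)%:E)).
  rewrite -monotone_convergence//.
  - by apply: eq_integral => x _; apply/esym/cvg_lim => //; exact: hg.
  - by move=> n; exact/measurable_EFinP.
  - by move=> n x _; rewrite lee_fin.
  - by move=> x _ m n mn; rewrite lee_fin hnd.
under eq_fun do rewrite integral_density_nnsfun.
rewrite -monotone_convergence//.
- apply: eq_integral => x _; apply/cvg_lim => //.
  by apply: cvgeZr => //; exact: hg.
- move=> n; apply: emeasurable_funM; exact/measurable_EFinP.
- by move=> n x _; rewrite mule_ge0// lee_fin.
- by move=> x _ m n mn; rewrite lee_wpmul2r ?lee_fin ?hnd.
Qed.

End density.

(** * Equality cases of termwise and pointwise inequalities *)

(** The values at stage 0 are arbitrary, so [u 0] may be negative. After the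
    shift every term is nonnegative, which is what exchanging and comparing
    series rests on. *)
Lemma nneseries_from1 (R : realType) (u : nat -> \bar R) :
  (forall n, 0 <= u n.+1) ->
  \sum_(1 <= n <oo) u n = \sum_(0 <= n <oo) u n.+1.
Proof.
move=> u0; pose v n := if n is 0 then 0 else u n.
transitivity (\sum_(1 <= n <oo) v n).
  by apply/congr_lim/funext => n; apply: eq_big_nat => -[|i].
rewrite -(@nneseries_addn _ v 1) => [|[|i]//]; last exact: u0.
by apply: eq_eseriesr => i _; rewrite addn1.
Qed.

(** The difference series has sum zero, because the finite sum of [u] cancels,
    and a nonnegative series of sum zero vanishes termwise. *)
Lemma eq_nneseries_le (R : realType) (u v : nat -> \bar R) :
  (forall n, 0 <= u n) -> (forall n, u n <= v n) ->
  \sum_(0 <= n <oo) v n < +oo ->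
  \sum_(0 <= n <oo) v n = \sum_(0 <= n <oo) u n <-> forall n, v n = u n.
Proof.
move=> u0 uv voo; split=> [vu n|vu]; last by apply: eq_eseriesr.
have suoo : \sum_(0 <= n <oo) u n \is a fin_num.
  by rewrite ge0_fin_numE ?nneseries_ge0// -vu.
have v0 m : 0 <= v m by exact: le_trans (uv m).
have uoo m : u m \is a fin_num.
  rewrite ge0_fin_numE//; apply: le_lt_trans voo.
  by rewrite vu (@nneseriesD1 _ u m)// leeDl// nneseries_ge0.
have w0 m : 0 <= v m - u m by rewrite sube_ge0// uoo.
have : \sum_(0 <= m <oo) (v m - u m) = 0.
  have : \sum_(0 <= m <oo) u m + \sum_(0 <= m <oo) (v m - u m) =
         \sum_(0 <= m <oo) u m.
    rewrite -nneseriesD// -[RHS]vu; apply: eq_eseriesr => m _.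
    by rewrite addeC subeK.
  move=> /(congr1 (fun z => z - \sum_(0 <= m <oo) u m)).
  by rewrite /= addeAC subee// add0e.
rewrite (@nneseriesD1 _ (fun m => v m - u m) n)// => /eqP.
rewrite padde_eq0 ?nneseries_ge0//.
by move=> /andP[/eqP vu0 _]; rewrite -(@subeK _ (v n) _ (uoo n)) vu0 add0e.
Qed.

(** The integral counterpart: [h - g] is nonnegative with integral zero. *)
Lemma eq_integral_le d (T : measurableType d) (R : realType)
    (mu : {measure set T -> \bar R}) (g h : T -> R) :
  measurable_fun [set: T] g -> measurable_fun [set: T] h ->
  (forall x, (0 <= g x)%R) -> (forall x, (g x <= h x)%R) ->
  \int[mu]_x (h x)%:E < +oo ->
  \int[mu]_x (h x)%:E = \int[mu]_x (g x)%:E <-> {ae mu, forall x, h x = g x}.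
Proof.
move=> mg mh g0 gh hoo.
have mhg : measurable_fun [set: T] (fun x => (h x - g x)%:E).
  by apply/measurable_EFinP; exact: measurable_funB.
have mEg : measurable_fun [set: T] (fun x => (g x)%:E).
  exact/measurable_EFinP.
have hg0 x : (0 <= h x - g x)%R by rewrite subr_ge0.
have hE : \int[mu]_x (h x)%:E =
    \int[mu]_x (g x)%:E + \int[mu]_x (h x - g x)%:E.
  rewrite -ge0_integralD//; try by move=> x _; rewrite lee_fin.
  by apply: eq_integral => x _; rewrite -EFinD addrC subrK.
have gfin : \int[mu]_x (g x)%:E \is a fin_num.
  rewrite ge0_fin_numE ?integral_ge0//; last by move=> x _; rewrite lee_fin.
  by apply: le_lt_trans hoo; rewrite hE leeDl// integral_ge0// => x _;
    rewrite lee_fin.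
have -> : \int[mu]_x (h x)%:E = \int[mu]_x (g x)%:E <->
          \int[mu]_x (h x - g x)%:E = 0.
  rewrite hE; split=> [|->]; last by rewrite adde0.
  move=> /(congr1 (fun z => z - \int[mu]_x (g x)%:E)).
  by rewrite /= addeAC subee// add0e.
have := @ae_eq_integral_abs _ T R mu setT measurableT _ mhg.
under eq_integral do rewrite gee0_abs ?lee_fin//.
move=> ->; split; apply: filterS => x /=.
  by move=> /(_ I) [] /eqP; rewrite subr_eq0 => /eqP.
by move=> -> _; rewrite subrr.
Qed.

(** The gap between the average and [m] is the sum of the nonnegative terms
    [w j * (D j - m)]; it vanishes exactly when [w j = 0] for every [j] such that
    [D j != m]. Weights of sum 1 never exceed 1, so the bound by the indicator
    of [D j = m] says just that. The factor [s], which may be 0, is what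
    confines the condition to the set where the test can stop. *)
Lemma weighted_average_min (R : realDomainType) (I : finType) (w D : I -> R)
    (m s : R) :
  (forall j, 0 <= w j)%R -> (\sum_j w j = 1)%R -> (forall j, m <= D j)%R ->
  (0 <= s)%R ->
  (s * m <= s * \sum_j w j * D j)%R /\
  ((s * \sum_j w j * D j = s * m)%R <->
   ((0 < s)%R -> forall j, (w j <= (D j == m)%:R)%R)).
Proof.
move=> w0 w1 mD s0.
have dE : (\sum_j w j * D j - m = \sum_j w j * (D j - m))%R.
  rewrite -[in LHS](mul1r m) -w1 mulr_suml -sumrB.
  by apply: eq_bigr => j _; rewrite mulrBr.
have t0 j : (0 <= w j * (D j - m))%R by rewrite mulr_ge0// subr_ge0.
split; first by rewrite ler_wpM2l// -subr_ge0 dE sumr_ge0.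
have [->|sn0] := eqVneq s 0%R; first by rewrite !mul0r ltxx; split.
split=> [/(mulfI sn0)/eqP + _ j|].
  rewrite -subr_eq0 dE psumr_eq0// => /allP/(_ j (mem_index_enum j))/=.
  rewrite mulf_eq0 subr_eq0 => /orP[/eqP ->|->]; first by rewrite ler0n.
  by rewrite -w1 (bigD1 j)//= lerDl sumr_ge0.
rewrite lt_neqAle eq_sym sn0 s0 => /(_ isT) wD; congr (_ * _)%R.
apply/eqP; rewrite -subr_eq0 dE big1// => j _.
have [->|Dm] := eqVneq (D j) m; first by rewrite subrr mulr0.
have := wD j; rewrite (negbTE Dm) => wj.
by have -> : w j = 0%R; [apply/eqP; rewrite eq_le wj w0|rewrite mul0r].
Qed.

(** * Sampling and stopping weights *)

Section sampling.
Context d0 (Omega : measurableType d0) d (T : measurableType d) (R : realType).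
Variables (X : nat -> {mfun Omega >-> T}) (psi : stopping_rule T R).

Lemma measurable_sample n : measurable_fun [set: Omega] (@sample _ _ _ _ X n).
Proof.
apply/measurable_fun_tnthP => i.
rewrite (_ : _ \o _ = X i.+1) //.
by apply/funext => w /=; rewrite tnth_mktuple.
Qed.

Lemma prefix_sample m n (lemn : (m <= n)%N) w :
  prefix_tuple lemn (sample X n w) = sample X m w.
Proof. by apply: eq_from_tnth => i; rewrite !tnth_mktuple. Qed.

Lemma measurable_prefix m n (lemn : (m <= n)%N) :
  measurable_fun [set: n.-tuple T] (@prefix_tuple _ T m n lemn).
Proof.
apply/measurable_fun_tnthP => i.
rewrite (_ : _ \o _ = (@tnth n T)^~ (widen_ord lemn i)).
  exact: measurable_tnth.
by apply/funext => x /=; rewrite tnth_mktuple.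
Qed.

Lemma measurable_stop_weight n : (0 < n)%N ->
  measurable_fun [set: n.-tuple T] (stop_weight psi (n := n)).
Proof.
move=> n0; apply: measurable_funM; last exact: stop_measurable.
under eq_fun do rewrite big_mkcond/=.
apply: measurable_prod => m _; case: (boolP (0 < m)%N) => // m0.
apply: measurable_funB => //.
exact: measurableT_comp (stop_measurable psi m0) (measurable_prefix _).
Qed.

Lemma stop_weight_ge0 n (x : n.-tuple T) : (0 < n)%N ->
  (0 <= stop_weight psi x)%R.
Proof.
move=> n0; rewrite mulr_ge0//; last by have /andP[] := stop_itv psi x n0.
apply: prodr_ge0 => m m0; rewrite subr_ge0.
by have /andP[] := stop_itv psi (prefix_tuple (ltnW (ltn_ord m)) x) m0.
Qed.

(** The weights telescope: stopping at one of the first [M] stages and passing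
    all of them are complementary, so the sum is 1 minus the product of the
    continuation factors. *)
Lemma sum_stop_weight_le1 M w :
  (\sum_(n < M) stop_weight psi (sample X n.+1 w) <= 1)%R.
Proof.
pose c m := psi m (sample X m w).
have c_itv m : (0 < m)%N -> (0 <= c m <= 1)%R by move=> m0; exact: stop_itv.
have weightE n : stop_weight psi (sample X n w) =
    ((\prod_(m < n | (0 < m)%N) (1 - c m)) * c n)%R.
  rewrite /stop_weight; congr (_ * _)%R.
  by apply: eq_bigr => m _; rewrite prefix_sample.
suff -> : (\sum_(n < M) stop_weight psi (sample X n.+1 w) =
           1 - \prod_(m < M.+1 | (0 < m)%N) (1 - c m))%R.
  rewrite gerBl prodr_ge0// => m m0; rewrite subr_ge0.
  by have /andP[] := c_itv _ m0.
elim: M => [|M IH].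
  by rewrite big_ord0 big_mkcond big_ord_recl big_ord0/= mulr1 subrr.
rewrite big_ord_recr/= IH weightE [in RHS]big_mkcond big_ord_recr/=.
by rewrite -big_mkcond/= mulrBr mulr1 opprD opprK addrA.
Qed.

Variables (mu : {sigma_finite_measure set T -> \bar R}).
Variable P : probability Omega R.

(** The law of the sample is its pushforward measure, which has density [f]. *)
Lemma expectation_sample n (f g : n.-tuple T -> R) :
  is_sample_density X mu P f -> measurable_fun [set: n.-tuple T] g ->
  (forall x, (0 <= g x)%R) ->
  'E_P[g \o @sample _ _ _ _ X n] =
  \int[power_measure mu n]_x ((g x)%:E * (f x)%:E).
Proof.
move=> [mf f0 fE] mg g0; rewrite unlock.
have mg' : measurable_fun [set: n.-tuple T] (fun x => (g x)%:E).
  exact/measurable_EFinP.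
have mS := @measurable_sample n.
have := @ge0_integral_density _ _ _ (power_measure mu n)
  (pushforward P (@sample _ _ _ _ X n)) f.
move=> /(_ mS mf f0 fE _ mg') <-; last by move=> x; rewrite lee_fin.
by rewrite ge0_integral_pushforward// => x _; rewrite lee_fin.
Qed.

End sampling.

(** * The error part of the Lagrangian *)

Section error_part.
Context (R : realType) d0 (Omega : measurableType d0) d (T : measurableType d).
Variables (mu : {sigma_finite_measure set T -> \bar R}).
Variables (Theta : Type) (P : Theta -> probability Omega R).
Variables (X : nat -> {mfun Omega >-> T}).
Variable f : Theta -> forall n : nat, n.-tuple T -> R.
Hypothesis hf : forall (vartheta : Theta) (n : nat), (0 < n)%N ->
  is_sample_density X mu (P vartheta) (@f vartheta n).
Variables (k : nat) (hyp : 'I_k -> Theta) (lambda : 'I_k -> 'I_k -> R).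
Hypothesis lambda_ge0 : forall i j : 'I_k, j != i -> (0 <= lambda i j)%R.
Variables (psi : stopping_rule T R) (phi : decision_rule T R k).

(** With the multipliers extended by 0 on the diagonal, the double sums over
    [j != i] become unrestricted and can be exchanged freely. *)
Let c i j : R := if j != i then lambda i j else 0%R.

Let c_ge0 i j : (0 <= c i j)%R.
Proof. by rewrite /c; case: ifP => // ij; exact: lambda_ge0. Qed.

Lemma decide_le1 n (j : 'I_k) (x : n.+1.-tuple T) : (phi n.+1 j x <= 1)%R.
Proof.
rewrite -(@decide_sum1 _ _ _ _ phi n.+1 x)// (bigD1 j)//= lerDl.
by apply: sumr_ge0 => i _; exact: decide_ge0.
Qed.

Let accept n (j : 'I_k) (x : n.+1.-tuple T) : R :=
  (stop_weight psi x * phi n.+1 j x)%R.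

Let accept_ge0 n j (x : n.+1.-tuple T) : (0 <= accept j x)%R.
Proof. by rewrite mulr_ge0 ?stop_weight_ge0 ?decide_ge0. Qed.

Let measurable_accept n j :
  measurable_fun [set: n.+1.-tuple T] (fun x => accept j x).
Proof.
apply: measurable_funM; first exact: measurable_stop_weight.
exact: decide_measurable.
Qed.

Let error_prob_shift i j :
  error_prob X P hyp psi phi i j =
  \sum_(0 <= n <oo)
    'E_(P (hyp i))[(fun x => accept j x) \o @sample _ _ _ _ X n.+1].
Proof.
rewrite /error_prob nneseries_from1// => n.
by apply: expectation_ge0 => w; exact: accept_ge0.
Qed.

(** Since [phi] is at most 1, a partial sum is bounded by the expected sum of
    the stopping weights, which telescopes to at most 1. *)
Lemma error_prob_le1 i j : error_prob X P hyp psi phi i j <= 1.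
Proof.
rewrite error_prob_shift; set u := (X in \sum_(0 <= n <oo) X n).
have u0 n : 0 <= u n by apply: expectation_ge0 => w; exact: accept_ge0.
apply: lime_le; first by apply: is_cvg_nneseries.
apply: nearW => M; rewrite big_mkord.
have ma n : measurable_fun [set: Omega]
    (fun w => (accept j (sample X n.+1 w))%:E).
  apply/measurable_EFinP.
  exact: measurableT_comp (@measurable_accept n j)
    (@measurable_sample _ _ _ _ X n.+1).
have uE n : u n = \int[P (hyp i)]_w (accept j (sample X n.+1 w))%:E.
  by rewrite /u expectation.unlock.
rewrite (eq_bigr _ (fun (n : 'I_M) _ => uE n)) -ge0_integral_sum//; last first.
  by move=> n w _; rewrite lee_fin accept_ge0.
rewrite -(@probability_setT _ _ _ (P (hyp i))) -[leRHS]mul1e.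
rewrite -(@integral_cst _ _ _ _ setT measurableT 1).
apply: ge0_le_integral => //.
- by move=> w _; apply: sume_ge0 => n _; rewrite lee_fin accept_ge0.
- exact: emeasurable_sum.
move=> w _; rewrite sumEFin lee_fin.
apply: le_trans (sum_stop_weight_le1 X psi M w); apply: ler_sum => n _.
by rewrite ler_piMr ?stop_weight_ge0// decide_le1.
Qed.

(** Every term is nonnegative, so sums, series and integrals may be exchanged;
    collecting the hypotheses [i] first leaves the loss of each decision [j]. *)
Lemma weighted_error_probE :
  \sum_(i < k) \sum_(j < k | j != i)
     (lambda i j)%:E * error_prob X P hyp psi phi i j =
  \sum_(0 <= n <oo) \int[power_measure mu n.+1]_x
     (stop_weight psi x *
      \sum_(j < k) phi n.+1 j x * decision_loss hyp lambda f j x)%:E.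
Proof.
transitivity (\sum_(i < k) \sum_(j < k)
    \sum_(0 <= n <oo) \int[power_measure mu n.+1]_x
      (c i j * (accept j x * f (hyp i) x))%:E).
  apply: eq_bigr => i _; rewrite big_mkcond/=; apply: eq_bigr => j _.
  transitivity ((c i j)%:E * error_prob X P hyp psi phi i j).
    by rewrite /c; case: ifP; rewrite ?mul0e.
  rewrite error_prob_shift -nneseriesZl; last first.
    by move=> n _; apply: expectation_ge0 => w; exact: accept_ge0.
  apply: eq_eseriesr => n _.
  have hfn := hf (hyp i) (ltn0Sn n); have [mf f0 _] := hfn.
  rewrite (expectation_sample hfn (@measurable_accept n j)); last first.
    by move=> x; exact: accept_ge0.
  under [RHS]eq_integral do rewrite EFinM (EFinM (accept _ _)).
  rewrite ge0_integralZl ?lee_fin//.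
  - apply: emeasurable_funM; apply/measurable_EFinP => //.
    exact: (@measurable_accept n j).
  - by move=> x _; rewrite -EFinM lee_fin mulr_ge0// accept_ge0.
have t0 i j n (x : n.+1.-tuple T) :
    0 <= (c i j * (accept j x * f (hyp i) x))%:E.
  by have [_ f0 _] := hf (hyp i) (ltn0Sn n); rewrite lee_fin;
    do 2![apply: mulr_ge0 => //].
have mt i j n : measurable_fun [set: n.+1.-tuple T]
    (fun x => (c i j * (accept j x * f (hyp i) x))%:E).
  have [mf _ _] := hf (hyp i) (ltn0Sn n).
  apply/measurable_EFinP/measurable_funM => //.
  exact: measurable_funM (@measurable_accept n j) mf.
have int0 i j n : 0 <= \int[power_measure mu n.+1]_x
    (c i j * (accept j x * f (hyp i) x))%:E.
  by apply: integral_ge0 => x _; exact: t0.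
under eq_bigr => i _ do rewrite -nneseries_sum//.
rewrite -nneseries_sum; last by move=> i n _; apply: sume_ge0.
apply: eq_eseriesr => n _.
under eq_bigr => i _ do (rewrite -ge0_integral_sum;
  [|exact: measurableT|move=> ?; exact: mt|move=> *; exact: t0]).
rewrite -ge0_integral_sum//; last 2 first.
- by move=> i; apply: emeasurable_sum => j; exact: mt.
- by move=> i x _; apply: sume_ge0 => j _; exact: t0.
apply: eq_integral => x _.
under eq_bigr do rewrite sumEFin.
rewrite sumEFin; congr EFin.
rewrite exchange_big mulr_sumr; apply: eq_bigr => j _.
rewrite mulrA -/(accept j x) /decision_loss mulr_sumr [RHS]big_mkcond/=.
apply: eq_bigr => i _; rewrite /c eq_sym.
by case: ifP => _; [rewrite mulrCA|rewrite mul0r].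
Qed.

Lemma weighted_error_prob_lty :
  \sum_(i < k) \sum_(j < k | j != i)
     (lambda i j)%:E * error_prob X P hyp psi phi i j
    < +oo.
Proof.
apply: lte_sum_pinfty => i _; apply: lte_sum_pinfty => j ij.
apply: (@le_lt_trans _ _ ((lambda i j)%:E * 1)); last by rewrite mule1 ltry.
by rewrite lee_wpmul2l ?lee_fin ?lambda_ge0// error_prob_le1.
Qed.

End error_part.

(** * The minimal loss *)

Section loss.
Context d (T : measurableType d) (R : realType) (Theta : Type) (k : nat).
Variables (f : Theta -> forall n : nat, n.-tuple T -> R).
Variables (hyp : 'I_k -> Theta) (lambda : 'I_k -> 'I_k -> R).
Hypothesis lambda_ge0 : forall i j : 'I_k, j != i -> (0 <= lambda i j)%R.
Hypothesis f_ge0 : forall vartheta n (x : n.+1.-tuple T),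
  (0 <= @f vartheta n.+1 x)%R.
Hypothesis measurable_f : forall vartheta n,
  measurable_fun [set: n.+1.-tuple T] (@f vartheta n.+1).

Lemma decision_loss_ge0 n (j : 'I_k) (x : n.+1.-tuple T) :
  (0 <= decision_loss hyp lambda f j x)%R.
Proof.
by apply: sumr_ge0 => i ij; rewrite mulr_ge0 ?f_ge0// lambda_ge0// eq_sym.
Qed.

Lemma measurable_decision_loss n (j : 'I_k) :
  measurable_fun [set: n.+1.-tuple T] (fun x => decision_loss hyp lambda f j x).
Proof.
rewrite /decision_loss; under eq_fun do rewrite big_mkcond/=.
apply: measurable_sum => i; case: (boolP (i != j)) => // _.
by apply: measurable_funM => //; exact: measurable_f.
Qed.

(** The pointwise comparison takes place among real numbers, where losses can be
    subtracted; for [0 < k] the minimum is finite and [fine] loses nothing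
    ([min_lossrE]). *)
Definition min_lossr n (x : n.-tuple T) : R := fine (min_loss hyp lambda f x).

Lemma min_loss_le n (x : n.-tuple T) (j : 'I_k) :
  min_loss hyp lambda f x <= (decision_loss hyp lambda f j x)%:E.
Proof. exact: bigmin_le_cond. Qed.

Lemma min_loss_ge0 n (x : n.+1.-tuple T) : 0 <= min_loss hyp lambda f x.
Proof. by apply: le_bigmin => // j _; rewrite lee_fin decision_loss_ge0. Qed.

Lemma min_lossrE n (x : n.+1.-tuple T) : (0 < k)%N ->
  (min_lossr x)%:E = min_loss hyp lambda f x.
Proof.
move=> k0; rewrite fineK// ge0_fin_numE ?min_loss_ge0//.
by rewrite (le_lt_trans (min_loss_le x (Ordinal k0)))// ltry.
Qed.

Lemma min_lossr_ge0 n (x : n.+1.-tuple T) : (0 <= min_lossr x)%R.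
Proof. by rewrite fine_ge0// min_loss_ge0. Qed.

Lemma min_lossr_le n (x : n.+1.-tuple T) (j : 'I_k) :
  (min_lossr x <= decision_loss hyp lambda f j x)%R.
Proof.
by rewrite -lee_fin min_lossrE ?min_loss_le// (leq_ltn_trans _ (ltn_ord j)).
Qed.

Lemma measurable_min_lossr n :
  measurable_fun [set: n.+1.-tuple T] (fun x => min_lossr x).
Proof.
suff mmin (s : seq 'I_k) : measurable_fun [set: n.+1.-tuple T]
    (fun x => \big[mine/+oo]_(j <- s) (decision_loss hyp lambda f j x)%:E).
  have mfine : measurable_fun [set: \bar R] (@fine R) by exact: fine_measurable.
  exact: (measurableT_comp mfine (mmin (index_enum _))).
elim: s => [|j s IH].
  by under eq_fun do rewrite big_nil; exact: measurable_cst.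
under eq_fun do rewrite big_cons/=.
apply: measurable_mine => //; apply/measurable_EFinP.
exact: (@measurable_decision_loss n j).
Qed.

End loss.

(** * The lower bound and its equality case *)

Theorem theorem3 (R : realType)
  (d0 : measure_display) (Omega : measurableType d0)
  (d : measure_display) (T : measurableType d)
  (mu : {sigma_finite_measure set T -> \bar R})
  (Theta : Type) (P : Theta -> probability Omega R)
  (X : nat -> {mfun Omega >-> T})
  (f : Theta -> forall n : nat, n.-tuple T -> R)
  (hf : forall (vartheta : Theta) (n : nat), (0 < n)%N ->
     is_sample_density X mu (P vartheta) (f vartheta n))
  (k : nat) (hk : (2 <= k)%N)
  (hyp : 'I_k -> Theta) (theta : Theta)
  (lambda : 'I_k -> 'I_k -> R)
  (hlambda : forall i j : 'I_k, j != i -> (0 <= lambda i j)%R)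
  (psi : stopping_rule T R) (phi : decision_rule T R k) :
  let N := average_sample_number X (P theta) psi in
  let L := lagrangian X P hyp theta lambda psi phi in
  let s n (x : n.-tuple T) := stop_weight psi x in
  let l n (x : n.-tuple T) := min_loss hyp lambda f x in
  let bound := N + \sum_(1 <= n <oo)
                     \int[power_measure mu n]_x ((s n x)%:E * l n x) in
  bound <= L /\
  (N \is a fin_num ->
    (L = bound <->
     forall n : nat, (0 < n)%N -> forall j : 'I_k,
       {ae power_measure mu n, forall x : n.-tuple T, (0 < s n x)%R ->
          (phi n j x <=
             \1_[set y : n.-tuple T |
                  (decision_loss hyp lambda f j y)%:E = l n y] x)%R})).
Proof.
have k0 : (0 < k)%N by exact: ltn_trans hk.
have f_ge0 v n (x : n.+1.-tuple T) : (0 <= f v n.+1 x)%R.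
  by have [_ f0 _] := hf v n.+1 isT.
have measurable_f v n : measurable_fun [set: n.+1.-tuple T] (f v n.+1).
  by have [] := hf v n.+1 isT.
move=> N L s l bound.
pose m n (x : n.-tuple T) := min_lossr f hyp lambda x.
pose D n (j : 'I_k) (x : n.-tuple T) := decision_loss hyp lambda f j x.
pose r n (x : n.+1.-tuple T) := (\sum_(j < k) phi n.+1 j x * D n.+1 j x)%R.
have mE n (x : n.+1.-tuple T) : (m n.+1 x)%:E = l n.+1 x.
  exact: min_lossrE.
have s0 n (x : n.+1.-tuple T) : (0 <= s n.+1 x)%R by exact: stop_weight_ge0.
(* the inequality and its equality case for one observed vector, before
   integration *)
have ptwise n (x : n.+1.-tuple T) : _ :=
  weighted_average_min (fun j => decide_ge0 phi j x (ltn0Sn n))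
    (decide_sum1 phi x (ltn0Sn n)) (min_lossr_le hyp hlambda f_ge0 x) (s0 n x).
pose a n := \int[power_measure mu n.+1]_x (s n.+1 x * m n.+1 x)%:E.
pose b n := \int[power_measure mu n.+1]_x (s n.+1 x * r n x)%:E.
have sm0 n (x : n.+1.-tuple T) : (0 <= s n.+1 x * m n.+1 x)%R.
  by rewrite mulr_ge0// min_lossr_ge0.
have sr_le n (x : n.+1.-tuple T) : (s n.+1 x * m n.+1 x <= s n.+1 x * r n x)%R.
  by have [] := ptwise n x.
have msm n : measurable_fun [set: n.+1.-tuple T]
    (fun x => s n.+1 x * m n.+1 x)%R.
  apply: measurable_funM; first exact: measurable_stop_weight.
  exact: measurable_min_lossr.
have msr n : measurable_fun [set: n.+1.-tuple T]
    (fun x => s n.+1 x * r n x)%R.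
  apply: measurable_funM; first exact: measurable_stop_weight.
  apply: measurable_sum => j; apply: measurable_funM.
    exact: decide_measurable.
  exact: measurable_decision_loss.
have a0 n : 0 <= a n by apply: integral_ge0 => x _; rewrite lee_fin.
have ab n : a n <= b n.
  apply: ge0_le_integral => //.
  - by move=> x _; rewrite lee_fin.
  - by apply/measurable_EFinP; exact: msm.
  - by apply/measurable_EFinP; exact: msr.
  - by move=> x _; rewrite lee_fin.
have LE : L = N + \sum_(0 <= n <oo) b n.
  by rewrite /L /lagrangian (weighted_error_probE hf).
have boundE : bound = N + \sum_(0 <= n <oo) a n.
  have aE n : \int[power_measure mu n.+1]_x ((s n.+1 x)%:E * l n.+1 x) = a n.
    by apply: eq_integral => x _; rewrite -mE -EFinM.
  rewrite /bound nneseries_from1; last by move=> n; rewrite aE.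
  by congr (_ + _); apply: eq_eseriesr => n _; exact: aE.
have boo : \sum_(0 <= n <oo) b n < +oo.
  rewrite -(weighted_error_probE hf hyp hlambda psi phi).
  exact: weighted_error_prob_lty.
have b0 n : 0 <= b n by exact: le_trans (ab n).
have bnoo n : b n < +oo.
  apply: le_lt_trans boo.
  by rewrite (@nneseriesD1 _ b n)// leeDl// nneseries_ge0.
rewrite LE boundE; split; first by rewrite leeD2l// lee_nneseries.
move=> Nfin.
have cancelN u v : N + u = N + v <-> u = v.
  split=> [/(congr1 (fun z => z - N))/=|->//].
  by rewrite addeAC [RHS]addeAC subee// !add0e.
rewrite cancelN eq_nneseries_le//.
have aeE n := eq_integral_le (msm n) (msr n) (sm0 n) (sr_le n) (bnoo n).
have -> : (forall n, b n = a n) <-> forall n, {ae power_measure mu n.+1,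
    forall x, forall j : 'I_k, (0 < s n.+1 x)%R ->
      (phi n.+1 j x <= (D n.+1 j x == m n.+1 x)%:R)%R}.
  split=> H n; last first.
    apply/aeE; have := H n; apply: filterS => x Hx.
    by apply/(ptwise n x).2 => s_gt0 j; exact: Hx.
  have : {ae power_measure mu n.+1, forall x,
      (s n.+1 x * r n x = s n.+1 x * m n.+1 x)%R}.
    by apply/aeE; exact: H.
  apply: filterS => x srm j s_gt0.
  by have [_ [/(_ srm s_gt0 j)]] := ptwise n x.
have indE n j (x : n.+1.-tuple T) :
    \1_[set y : n.+1.-tuple T | (D n.+1 j y)%:E = l n.+1 y] x =
    (D n.+1 j x == m n.+1 x)%:R :> R.
  rewrite indicE; congr (nat_of_bool _)%:R; apply/idP/eqP.
    by rewrite inE /= -mE => -[].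
  by rewrite inE /= -mE => ->.
split=> [H [//|n] _ j|H n].
  by apply: filterS (H n) => x + s_gt0; rewrite indE; exact.
apply: filter_forall => j; apply: filterS (H n.+1 isT j) => x.
by rewrite indE.
Qed.
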